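(* Let $\Theta$ be a set of formulas and $\varphi$ a formula of $\mathcal{FMVL}$. The following are equivalent: (1) $\Theta\vdash\varphi$; (2) $\Theta\models_A\varphi$ for every unital commutative fMV-algebra $A$; (3) $\Theta\models_A\varphi$ for every totally-ordered unital commutative fMV-algebra $A$; (4) $[\varphi]_\Theta=1_\Theta$ in the Lindenbaum algebra $fMVL(\Theta)$.
   Context: MV-algebra: $(A,\oplus,{}^*,0)$ with $(A,\oplus,0)$ a commutative monoid, $(x^* )^*=x$, $x\oplus0^*=0^*$, $(x^*\oplus y)^*\oplus y=(y^*\oplus x)^*\oplus x$; $1=0^*$, $x\odot y=(x^*\oplus y^* )^*$, $x\le y$ iff $x\odot y^*=0$ (lattice order, $x\wedge y=x\odot(x^*\oplus y)$). An fMV-algebra is $(A,\oplus,\cdot,{}^*,\{\alpha\}_{\alpha\in[0,1]},0)$ where $(A,\oplus,{}^*,0)$ is an MV-algebra, $\cdot$ is associative with $z\cdot(x\odot(x\wedge y)^* )=(z\cdot x)\odot(z\cdot(x\wedge y))^*$, $(x\odot(x\wedge y)^* )\cdot z=(x\cdot z)\odot((x\wedge y)\cdot z)^*$, and $x\wedge y=0\Rightarrow(x\cdot z)\wedge y=(z\cdot x)\wedge y=0$; the unary operations satisfy $\alpha(x\odot y^* )=(\alpha x)\odot(\alpha y)^*$, $\max(0,\alpha-\beta)x=(\alpha x)\odot(\beta x)^*$, $\alpha(\beta x)=(\alpha\beta)x$, $1x=x$; and $\alpha(x\cdot y)=(\alpha x)\cdot y=x\cdot(\alpha y)$. Unital: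 $\cdot$ has an identity; commutative: $\cdot$ commutative. Formulas of $\mathcal{FMVL}$ are built from variables $v_1,v_2,\dots$ with binary $\to,\cdot$ and unary $\neg$, $\nabla_\alpha$ ($\alpha\in[0,1]$). Abbreviations: $\varphi\oplus\psi=\neg\varphi\to\psi$, $\varphi\odot\psi=\neg(\neg\varphi\oplus\neg\psi)$, $\varphi\vee\psi=(\varphi\to\psi)\to\psi$, $\varphi\ominus\psi=\neg(\varphi\to\psi)$, $\Delta_\alpha\varphi=\neg\nabla_\alpha\neg\varphi$, $\varphi\leftrightarrow\psi=(\varphi\to\psi)\odot(\psi\to\varphi)$. Axioms (all instances): (L1) $\varphi\to(\psi\to\varphi)$; (L2) $(\varphi\to\psi)\to((\psi\to\chi)\to(\varphi\to\chi))$; (L3) $(\varphi\vee\psi)\to(\psi\vee\varphi)$; (L4) $(\neg\psi\to\neg\varphi)\to(\varphi\to\psi)$; (R1) $\nabla_\alpha(\varphi\to\psi)\leftrightarrow(\nabla_\alpha\varphi\to\nabla_\alpha\psi)$; (R2) $\nabla_{\max(0,\alpha-\beta)}\varphi\leftrightarrow(\nabla_\beta\varphi\to\nabla_\alpha\varphi)$; (R3) $\nabla_\alpha\nabla_\beta\varphi\leftrightarrow\nabla_{\alpha\beta}\varphi$; (R4) $\nabla_1\varphi\leftrightarrow\varphi$; (P1) $(\chi\cdot(\varphi\ominus\psi))\leftrightarrow((\chi\cdot\varphi)\ominus(\chi\cdot\psi))$; (P2) $(\varphi\cdot(\psi\cdot\chi))\leftrightarrow((\varphi\cdot\psi)\cdot\chi)$;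 (P3) $\varphi\to(\varphi\cdot(\varphi\to\varphi))$; (P4) $\varphi\cdot\psi\to\varphi$; (P5) $\varphi\cdot\psi\leftrightarrow\psi\cdot\varphi$; (A1) $\Delta_\alpha(\varphi\cdot\psi)\leftrightarrow(\Delta_\alpha\varphi\cdot\psi)$; (A2) $\Delta_\alpha(\varphi\cdot\psi)\leftrightarrow(\varphi\cdot\Delta_\alpha\psi)$. The only rule is Modus Ponens; $\Theta\vdash\varphi$ means $\varphi$ is derivable from axioms and $\Theta$. An evaluation into an fMV-algebra $A$ is a map $e$ from formulas to $A$ with $e(\varphi\to\psi)=e(\varphi)^*\oplus e(\psi)$, $e(\neg\varphi)=e(\varphi)^*$, $e(\nabla_\alpha\varphi)=(\alpha e(\varphi)^* )^*$, $e(\varphi\cdot\psi)=e(\varphi)\cdot e(\psi)$. $\Theta\models_A\varphi$ means $e(\varphi)=1$ for every evaluation $e$ into $A$ with $e(\theta)=1$ for all $\theta\in\Theta$. For $\Theta$, set $\varphi\equiv_\Theta\psi$ iff $\Theta\vdash\varphi\to\psi$ and $\Theta\vdash\psi\to\varphi$; $fMVL(\Theta)$ is the quotient of the formulas by $\equiv_\Theta$ with operations induced by the connectives ($[\varphi]^*=[\neg\varphi]$, $[\varphi]\oplus[\psi]=[\neg\varphi\to\psi]$, $[\varphi]\cdot[\psi]=[\varphi\cdot\psi]$, $\alpha[\varphi]=[\Delta_\alpha\varphi]$), with $1_\Theta$ the class of formulas derivable from $\Theta$ and $0_\Theta=1_\Theta^*$. *)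

(* Defs.v *)
From mathcomp Require Import all_boot all_order all_algebra.
From mathcomp Require Import boolp classical_sets reals interval_inference.

Set Implicit Arguments.
Unset Strict Implicit.
Unset Printing Implicit Defensive.

Import Order.TTheory GRing.Theory Num.Theory.
Local Open Scope ring_scope.
Local Open Scope classical_set_scope.

Declare Scope fmv_scope.
Delimit Scope fmv_scope with fmv.
Declare Scope fml_scope.
Delimit Scope fml_scope with fml.

Reserved Notation "x \oplus y" (at level 50, left associativity).
Reserved Notation "x \odot y" (at level 40, left associativity).
Reserved Notation "x \cdot y" (at level 40, left associativity).
Reserved Notation "x \wedge y" (at level 45, left associativity).
Reserved Notation "x \vee y" (at level 50, left associativity).
Reserved Notation "x \ominus y" (at level 50, left associativity).
Reserved Notation "x ~> y" (at level 55, right associativity).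
Reserved Notation "x <~> y" (at level 60, no associativity).

(* Algebras of the fMV signature, without axioms.  The scalars range over the
   real unit interval [{i01 R}]. *)
Record fmvSig (R : realType) : Type := FmvSig {
  carrier :> Type;
  oplus : carrier -> carrier -> carrier;
  prd : carrier -> carrier -> carrier;
  compl : carrier -> carrier;
  scal : {i01 R} -> carrier -> carrier;
  zero : carrier }.

Arguments zero {R} _.

Definition one (R : realType) (A : fmvSig R) : A := compl (zero A).
Arguments one {R} A.

Definition odot (R : realType) (A : fmvSig R) (x y : A) : A :=
  compl (oplus (compl x) (compl y)).

Definition meet (R : realType) (A : fmvSig R) (x y : A) : A :=
  odot x (oplus (compl x) y).

Definition mv_le (R : realType) (A : fmvSig R) (x y : A) : Prop :=
  odot x (compl y) = zero A.

Notation "x \oplus y" := (oplus x y) : fmv_scope.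
Notation "x \odot y" := (odot x y) : fmv_scope.
Notation "x \cdot y" := (prd x y) : fmv_scope.
Notation "x \wedge y" := (meet x y) : fmv_scope.
Notation "x ^*" := (compl x) : fmv_scope.

Record is_mv (R : realType) (A : fmvSig R) : Prop := IsMV {
  mv_oplusA : associative (@oplus R A);
  mv_oplusC : commutative (@oplus R A);
  mv_oplus0 : right_id (zero A) (@oplus R A);
  mv_complK : forall x : A, (x^*^* = x)%fmv;
  mv_oplus1 : forall x : A, (x \oplus (zero A)^* = (zero A)^*)%fmv;
  mv_luka : forall x y : A,
    ((x^* \oplus y)^* \oplus y = (y^* \oplus x)^* \oplus x)%fmv }.

Record is_fmv (R : realType) (A : fmvSig R) : Prop := IsFMV {
  fmv_mv : is_mv A;
  fmv_prdA : associative (@prd R A);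
  fmv_prdDr : forall x y z : A,
    (z \cdot (x \odot (x \wedge y)^*)
       = (z \cdot x) \odot (z \cdot (x \wedge y))^*)%fmv;
  fmv_prdDl : forall x y z : A,
    ((x \odot (x \wedge y)^*) \cdot z
       = (x \cdot z) \odot ((x \wedge y) \cdot z)^*)%fmv;
  fmv_prd_disj : forall x y z : A, (x \wedge y)%fmv = zero A ->
    ((x \cdot z) \wedge y)%fmv = zero A /\ ((z \cdot x) \wedge y)%fmv = zero A;
  fmv_scalB : forall (a : {i01 R}) (x y : A),
    (scal a (x \odot y^*) = scal a x \odot (scal a y)^*)%fmv;
  fmv_scalBl : forall (a b : {i01 R}) (x : A),
    scal (Num.max 0 (a%:num - b%:num))%:i01 x
      = (scal a x \odot (scal b x)^*)%fmv;
  fmv_scalA : forall (a b : {i01 R}) (x : A),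
    scal a (scal b x) = scal (a%:num * b%:num)%:i01 x;
  fmv_scal1 : forall x : A, scal (1 : R)%:i01 x = x;
  fmv_scalAl : forall (a : {i01 R}) (x y : A),
    (scal a (x \cdot y) = scal a x \cdot y)%fmv;
  fmv_scalAr : forall (a : {i01 R}) (x y : A),
    (scal a (x \cdot y) = x \cdot scal a y)%fmv }.

Record fmvAlgebra (R : realType) : Type := FmvAlgebra {
  fmv_sig :> fmvSig R;
  fmv_axioms : is_fmv fmv_sig }.

(* The identity of the product is not required to be the top element [one A]. *)
Definition unital (R : realType) (A : fmvSig R) : Prop :=
  exists u : A, left_id u (@prd R A) /\ right_id u (@prd R A).

Definition commutative_fmv (R : realType) (A : fmvSig R) : Prop :=
  commutative (@prd R A).

Definition totally_ordered (R : realType) (A : fmvSig R) : Prop :=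
  forall x y : A, mv_le x y \/ mv_le y x.

(* [Var n] is the variable v_(n+1). *)
Inductive formula (R : realType) : Type :=
| Var of nat
| Imp of formula R & formula R
| Prd of formula R & formula R
| Neg of formula R
| Nabla of {i01 R} & formula R.

Arguments Var {R} n.
Bind Scope fml_scope with formula.

Notation "p ~> q" := (Imp p q) : fml_scope.
Notation "p \cdot q" := (Prd p q) : fml_scope.

Definition foplus (R : realType) (p q : formula R) : formula R :=
  (Neg p ~> q)%fml.
Definition fodot (R : realType) (p q : formula R) : formula R :=
  Neg (foplus (Neg p) (Neg q)).
Definition fvee (R : realType) (p q : formula R) : formula R :=
  ((p ~> q) ~> q)%fml.
Definition fominus (R : realType) (p q : formula R) : formula R :=
  Neg (p ~> q)%fml.
Definition Delta (R : realType) (a : {i01 R}) (p : formula R) : formula R :=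
  Neg (Nabla a (Neg p)).
Definition fiff (R : realType) (p q : formula R) : formula R :=
  fodot (p ~> q)%fml (q ~> p)%fml.

Notation "p \oplus q" := (foplus p q) : fml_scope.
Notation "p \odot q" := (fodot p q) : fml_scope.
Notation "p \vee q" := (fvee p q) : fml_scope.
Notation "p \ominus q" := (fominus p q) : fml_scope.
Notation "p <~> q" := (fiff p q) : fml_scope.

Inductive fmvl_axiom (R : realType) : formula R -> Prop :=
| L1 p q : fmvl_axiom (p ~> (q ~> p))
| L2 p q r : fmvl_axiom ((p ~> q) ~> ((q ~> r) ~> (p ~> r)))
| L3 p q : fmvl_axiom ((p \vee q) ~> (q \vee p))
| L4 p q : fmvl_axiom ((Neg q ~> Neg p) ~> (p ~> q))
| R1 (a : {i01 R}) p q : fmvl_axiom (Nabla a (p ~> q) <~> (Nabla a p ~> Nabla a q))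
| R2 (a b : {i01 R}) p : fmvl_axiom
    (Nabla (Num.max 0 (a%:num - b%:num))%:i01 p <~> (Nabla b p ~> Nabla a p))
| R3 (a b : {i01 R}) p : fmvl_axiom
    (Nabla a (Nabla b p) <~> Nabla (a%:num * b%:num)%:i01 p)
| R4 p : fmvl_axiom (Nabla (1 : R)%:i01 p <~> p)
| P1 p q r : fmvl_axiom
    ((r \cdot (p \ominus q)) <~> ((r \cdot p) \ominus (r \cdot q)))
| P2 p q r : fmvl_axiom ((p \cdot (q \cdot r)) <~> ((p \cdot q) \cdot r))
| P3 p : fmvl_axiom (p ~> (p \cdot (p ~> p)))
| P4 p q : fmvl_axiom ((p \cdot q) ~> p)
| P5 p q : fmvl_axiom ((p \cdot q) <~> (q \cdot p))
| A1 (a : {i01 R}) p q : fmvl_axiom (Delta a (p \cdot q) <~> (Delta a p \cdot q))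
| A2 (a : {i01 R}) p q : fmvl_axiom (Delta a (p \cdot q) <~> (p \cdot Delta a q)).

Inductive derivable (R : realType) (Theta : set (formula R)) :
    formula R -> Prop :=
| D_axiom p : fmvl_axiom p -> derivable Theta p
| D_hyp p : Theta p -> derivable Theta p
| D_MP p q : derivable Theta p -> derivable Theta (p ~> q) -> derivable Theta q.

Record evaluation (R : realType) (A : fmvSig R) (e : formula R -> A) : Prop :=
  Evaluation {
  ev_imp : forall p q, e (p ~> q)%fml = ((e p)^* \oplus e q)%fmv;
  ev_neg : forall p, e (Neg p) = ((e p)^*)%fmv;
  ev_nabla : forall a p, e (Nabla a p) = ((scal a (e p)^*)^*)%fmv;
  ev_prd : forall p q, e (p \cdot q)%fml = (e p \cdot e q)%fmv }.

Definition models (R : realType) (Theta : set (formula R)) (A : fmvSig R)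
    (p : formula R) : Prop :=
  forall e : formula R -> A, evaluation e ->
    (forall t, Theta t -> e t = one A) -> e p = one A.

Section Derived.
Context {R : realType} {Theta : set (formula R)}.
Implicit Types p q r : formula R.
Local Notation "|- p" := (derivable Theta p) (at level 70).

Let L1' p q : |- p ~> (q ~> p). Proof. exact/D_axiom/L1. Qed.
Let L2' p q r : |- (p ~> q) ~> ((q ~> r) ~> (p ~> r)).
Proof. exact/D_axiom/L2. Qed.
Let L4' p q : |- (Neg q ~> Neg p) ~> (p ~> q). Proof. exact/D_axiom/L4. Qed.

Lemma imp_trans q p r : |- p ~> q -> |- q ~> r -> |- p ~> r.
Proof. by move=> pq qr; apply: D_MP qr (D_MP pq (L2' p q r)). Qed.

Let imp_apply p q : |- p ~> ((p ~> q) ~> q).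
Proof. exact: imp_trans (L1' p (q ~> p)%fml) (D_axiom _ (L3 _ _)). Qed.

Lemma imp_refl p : |- p ~> p.
Proof.
apply: (imp_trans (L1' p (p ~> (p ~> p)))).
exact: D_MP (L1' p p) (imp_apply _ _).
Qed.

Lemma imp_swap p q r : |- p ~> (q ~> r) -> |- q ~> (p ~> r).
Proof. by move=> pqr; apply: imp_trans (imp_apply q r) (D_MP pqr (L2' _ _ _)). Qed.

Lemma imp_suffix r p q : |- p ~> q -> |- (q ~> r) ~> (p ~> r).
Proof. by move=> pq; apply: D_MP pq (L2' _ _ _). Qed.

Lemma imp_prefix r p q : |- p ~> q -> |- (r ~> p) ~> (r ~> q).
Proof. by move=> pq; apply: D_MP pq (imp_swap (L2' _ _ _)). Qed.

Lemma neg_negE p : |- Neg (Neg p) ~> p.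
Proof.
have T := imp_refl p.
have H : |- Neg (Neg p) ~> ((p ~> p) ~> p).
  exact: imp_trans (L1' _ _) (imp_trans (L4' _ _) (L4' _ _)).
exact: D_MP T (imp_swap H).
Qed.

Lemma neg_negI p : |- p ~> Neg (Neg p).
Proof. exact: D_MP (neg_negE (Neg p)) (L4' _ _). Qed.

Lemma contra p q : |- p ~> q -> |- Neg q ~> Neg p.
Proof.
move=> pq; apply: D_MP (L4' _ _).
exact: imp_trans (neg_negE p) (imp_trans pq (neg_negI q)).
Qed.

Lemma iffLR p q : |- (p <~> q) -> |- p ~> q.
Proof.
move=> H; apply: (D_MP H); apply: imp_trans (neg_negE _).
apply: contra; apply: imp_trans (L4' _ _).
apply: imp_trans (L1' _ (Neg (Neg (q ~> p)))) _.
exact: imp_prefix (neg_negI _).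
Qed.

Lemma iffRL p q : |- (p <~> q) -> |- q ~> p.
Proof.
move=> H; apply: (D_MP H); apply: imp_trans (neg_negE _).
by apply: contra; apply: L1'.
Qed.

Lemma nabla0 p : |- Nabla (Num.max 0 ((1 : R)%:i01%:num - (1 : R)%:i01%:num))%:i01 p.
Proof. exact: D_MP (imp_refl _) (iffRL (D_axiom _ (R2 _ _ _))). Qed.

Lemma nabla_nec a p : |- p -> |- Nabla a p.
Proof.
move=> Hp; have H1 := D_MP Hp (iffRL (D_axiom _ (R4 p))).
apply: (D_MP H1); apply: D_MP (iffLR (D_axiom _ (R2 a (1 : R)%:i01 p))).
have -> : (Num.max 0 (a%:num - (1 : R)%:i01%:num))%:i01 =
          (Num.max 0 ((1 : R)%:i01%:num - (1 : R)%:i01%:num))%:i01 :> {i01 R}.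
  apply: val_inj => /=; rewrite subrr maxxx; apply/max_idPl.
  by rewrite subr_le0.
exact: nabla0.
Qed.

Lemma nabla_mono a p q : |- p ~> q -> |- Nabla a p ~> Nabla a q.
Proof. by move=> /(nabla_nec a) H; apply: D_MP H (iffLR (D_axiom _ (R1 _ _ _))). Qed.

Lemma Delta_mono a p q : |- p ~> q -> |- Delta a p ~> Delta a q.
Proof. by move=> pq; apply/contra/nabla_mono/contra. Qed.

Lemma prd_monor r p q : |- p ~> q -> |- (r \cdot p) ~> (r \cdot q).
Proof.
move=> pq; apply: (D_MP pq); apply: D_MP (L4' _ _).
apply: imp_trans (iffRL (D_axiom _ (P1 p q r))) _.
apply: imp_trans (iffLR (D_axiom _ (P5 _ _))) _.
exact: D_axiom (P4 _ _).
Qed.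

Lemma prd_monol r p q : |- p ~> q -> |- (p \cdot r) ~> (q \cdot r).
Proof.
move=> pq; apply: imp_trans (iffLR (D_axiom _ (P5 _ _))) _.
exact: imp_trans (prd_monor r pq) (iffLR (D_axiom _ (P5 _ _))).
Qed.

End Derived.

Definition lequiv (R : realType) (Theta : set (formula R)) (p q : formula R) :
    Prop :=
  derivable Theta (p ~> q) /\ derivable Theta (q ~> p).

Definition eq_class (R : realType) (Theta : set (formula R)) (p : formula R) :
    set (formula R) := [set q | lequiv Theta p q].

Definition lindenbaum_sort (R : realType) (Theta : set (formula R)) : Type :=
  {C : set (formula R) | exists p, C = eq_class Theta p}.

Definition cls (R : realType) (Theta : set (formula R)) (p : formula R) :
    lindenbaum_sort Theta :=
  exist _ (eq_class Theta p) (ex_intro _ p erefl).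

(* A chosen representative; the operations defined from it do not depend on
   the choice, see the lemmas [cls_oplus], [cls_prd], [cls_compl], [cls_scal]. *)
Definition lrepr (R : realType) (Theta : set (formula R))
    (C : lindenbaum_sort Theta) : formula R :=
  sval (cid (proj2_sig C)).

Section LequivTheory.
Context {R : realType} {Theta : set (formula R)}.
Implicit Types p q : formula R.

Lemma lequiv_refl p : lequiv Theta p p.
Proof. by split; apply: imp_refl. Qed.

Lemma lequiv_sym p q : lequiv Theta p q -> lequiv Theta q p.
Proof. by case. Qed.

Lemma lequiv_trans q p r :
  lequiv Theta p q -> lequiv Theta q r -> lequiv Theta p r.
Proof.
by move=> [pq qp] [qr rq]; split; [apply: (imp_trans pq)|apply: (imp_trans rq)].
Qed.

Lemma eq_classP p q : eq_class Theta p = eq_class Theta q <-> lequiv Theta p q.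
Proof.
split=> [E|pq].
  by suff: eq_class Theta p q by []; rewrite E; apply: lequiv_refl.
apply/seteqP; split=> r /= H; first exact: lequiv_trans (lequiv_sym pq) H.
exact: lequiv_trans pq H.
Qed.

Lemma lindenbaum_inj (C D : lindenbaum_sort Theta) : sval C = sval D -> C = D.
Proof.
by case: C D => [C HC] [D HD] /= E; subst D; congr exist; apply: Prop_irrelevance.
Qed.

Lemma clsP p q : cls Theta p = cls Theta q <-> lequiv Theta p q.
Proof.
rewrite -eq_classP; split=> [/(congr1 sval)//|E]; exact: lindenbaum_inj.
Qed.

Lemma lreprK (C : lindenbaum_sort Theta) : cls Theta (lrepr C) = C.
Proof. by apply: lindenbaum_inj; rewrite /lrepr; case: cid. Qed.

Lemma lrepr_cls p : lequiv Theta (lrepr (cls Theta p)) p.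
Proof. by apply/clsP; rewrite lreprK. Qed.

Lemma derivable_class :
  exists p, [set q | derivable Theta q] = eq_class Theta p.
Proof.
exists (Var 0 ~> Var 0)%fml; apply/seteqP; split=> q /= => [H|[H _]].
  split; first exact: D_MP H (D_axiom _ (L1 _ _)).
  exact: D_MP (imp_refl _) (D_axiom _ (L1 _ _)).
exact: D_MP (imp_refl _) H.
Qed.

End LequivTheory.

Definition lone (R : realType) (Theta : set (formula R)) :
    lindenbaum_sort Theta :=
  exist _ [set q | derivable Theta q] derivable_class.

Definition lcompl (R : realType) (Theta : set (formula R))
    (C : lindenbaum_sort Theta) : lindenbaum_sort Theta :=
  cls Theta (Neg (lrepr C)).

Definition fMVL (R : realType) (Theta : set (formula R)) : fmvSig R :=
  @FmvSig R (lindenbaum_sort Theta)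
    (fun C D => cls Theta (Neg (lrepr C) ~> lrepr D))
    (fun C D => cls Theta (lrepr C \cdot lrepr D))
    (@lcompl R Theta)
    (fun a C => cls Theta (Delta a (lrepr C)))
    (lcompl (lone Theta)).

Section LindenbaumTheory.
Context {R : realType} {Theta : set (formula R)}.
Implicit Types p q : formula R.
Local Notation "[ p ]" := (cls Theta p : fMVL Theta) (at level 0).

Lemma cls_compl p : (([p])^*)%fmv = [Neg p].
Proof. by apply/clsP; have [? ?] := @lrepr_cls _ Theta p; split; apply: contra. Qed.

Lemma cls_oplus p q : ([p] \oplus [q])%fmv = [Neg p ~> q].
Proof.
apply/clsP; have [p1 p2] := @lrepr_cls _ Theta p.
have [q1 q2] := @lrepr_cls _ Theta q; split.
  exact: imp_trans (imp_suffix _ (contra p1)) (imp_prefix _ q1).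
exact: imp_trans (imp_suffix _ (contra p2)) (imp_prefix _ q2).
Qed.

Lemma cls_prd p q : ([p] \cdot [q])%fmv = [p \cdot q].
Proof.
apply/clsP; have [p1 p2] := @lrepr_cls _ Theta p.
have [q1 q2] := @lrepr_cls _ Theta q; split.
  exact: imp_trans (prd_monol _ p1) (prd_monor _ q1).
exact: imp_trans (prd_monol _ p2) (prd_monor _ q2).
Qed.

Lemma cls_scal a p : scal a [p] = [Delta a p].
Proof.
by apply/clsP; have [? ?] := @lrepr_cls _ Theta p; split; apply: Delta_mono.
Qed.

Lemma one_fMVL : one (fMVL Theta) = lone Theta.
Proof.
rewrite /one -[zero _]/(cls Theta (Neg (lrepr (lone Theta))) : fMVL Theta).
rewrite cls_compl -[RHS]lreprK; apply/clsP.
by split; [apply: neg_negE | apply: neg_negI].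
Qed.

End LindenbaumTheory.

(* Main.v *)
(** Soundness of (P1), which lacks the meet of the algebraic axiom, rests on
    prelinearity: [z (x - y)] and [z (y - x)] are disjoint because [x - y] and
    [y - x] are, so [z x - z (x /\ y)] and [z x - z y] coincide.  Soundness of
    (P3) and (P4) holds because the identity of the product is the top element.

    For completeness, if [Theta] does not derive [phi], Zorn's lemma gives a
    [T] containing [Theta] maximal among the sets not deriving [phi].  If [T]
    derived neither [p ~> q] nor [q ~> p], then [phi] would follow in [T] from
    a power of each by the local deduction theorem, hence outright by
    prelinearity.  So the Lindenbaum algebra of [T] is a chain, and [phi] fails
    in it under the canonical evaluation. *)

Require Import Defs.
From mathcomp Require Import all_boot all_order all_algebra.
From mathcomp Require Import boolp classical_sets reals interval_inference.
(* [classical_sets] shadows [one] and [zero]. *)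
Import Defs.

Set Implicit Arguments.
Unset Strict Implicit.
Unset Printing Implicit Defensive.

(** * MV-algebras *)

Section MVTheory.
Context {R : realType} {A : fmvSig R} (mvA : is_mv A).
Implicit Types x y z : A.
Local Open Scope fmv_scope.

Let oA := mv_oplusA mvA.
Let oC := mv_oplusC mvA.

Lemma oplusCA : left_commutative (@oplus R A).
Proof. by move=> x y z; rewrite !oA (oC x). Qed.

Lemma compl_one : (one A)^* = zero A.
Proof. exact: mv_complK. Qed.

Lemma oplus0x : left_id (zero A) (@oplus R A).
Proof. by move=> x; rewrite oC (mv_oplus0 mvA). Qed.

Lemma oplusx1 x : x \oplus one A = one A.
Proof. exact: mv_oplus1. Qed.

Lemma oplus1x x : one A \oplus x = one A.
Proof. by rewrite oC oplusx1. Qed.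

Lemma oplusNx x : x^* \oplus x = one A.
Proof.
(* With the top as second argument, one side collapses to the top and the other to
   [x^* \oplus x]. *)
have := mv_luka mvA x (one A).
by rewrite !oplusx1 compl_one oplus0x.
Qed.

Lemma oplusxN x : x \oplus x^* = one A.
Proof. by rewrite oC oplusNx. Qed.

Lemma compl_odot x y : (x \odot y)^* = x^* \oplus y^*.
Proof. exact: mv_complK. Qed.

Lemma compl_oplus x y : (x \oplus y)^* = x^* \odot y^*.
Proof. by rewrite /odot !(mv_complK mvA). Qed.

Lemma odotC : commutative (@odot R A).
Proof. by move=> x y; rewrite /odot oC. Qed.

Lemma odotA : associative (@odot R A).
Proof. by move=> x y z; rewrite /odot !(mv_complK mvA) oA. Qed.

Lemma odotx1 : right_id (one A) (@odot R A).
Proof.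
by move=> x; rewrite /odot compl_one (mv_oplus0 mvA) (mv_complK mvA).
Qed.

Lemma odot0x x : zero A \odot x = zero A.
Proof. by rewrite /odot oplus1x compl_one. Qed.

Lemma odotxN x : x \odot x^* = zero A.
Proof. by rewrite /odot oplusxN compl_one. Qed.

(** The Łukasiewicz axiom at [x^*] and [y^*], complemented. *)
Lemma meetC : commutative (@meet R A).
Proof.
move=> x y; rewrite /meet ![_ \odot (_ \oplus _)]odotC /odot; congr (_^*).
have := mv_luka mvA x^* y^*; rewrite !(mv_complK mvA) => E.
by rewrite [x^* \oplus y]oC [y^* \oplus x]oC.
Qed.

Lemma mv_leP x y : mv_le x y <-> x^* \oplus y = one A.
Proof.
rewrite /mv_le /odot (mv_complK mvA); split=> [E|->]; last exact: compl_one.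
by rewrite -[LHS](mv_complK mvA) E.
Qed.

Lemma mv_le_meet x y : mv_le x y -> x \wedge y = x.
Proof. by move/mv_leP=> E; rewrite /meet E odotx1. Qed.

Lemma mv_le_anti x y : mv_le x y -> mv_le y x -> x = y.
Proof. by move=> /mv_le_meet xy /mv_le_meet yx; rewrite -yx meetC xy. Qed.

Lemma odot_le x y : mv_le (x \odot y) x.
Proof. by apply/mv_leP; rewrite compl_odot -oA oplusCA oplusNx oplusx1. Qed.

Lemma meet_lel x y : mv_le (x \wedge y) x.
Proof. exact: odot_le. Qed.

Lemma mv_lex0 x : mv_le x (zero A) -> x = zero A.
Proof. by rewrite /mv_le -/(one A) odotx1. Qed.

Lemma mv_le1 x : mv_le x (one A).
Proof. by apply/mv_leP; rewrite oplusx1. Qed.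

(** Algebraic form of (L2). The Łukasiewicz axiom turns [(y^* \oplus z)^* \oplus z] into a sum with
    summand [y]; together with [x^*] this [y] cancels [(x^* \oplus y)^*]. *)
Lemma imp_transitive x y z :
  (x^* \oplus y)^* \oplus ((y^* \oplus z)^* \oplus (x^* \oplus z)) = one A.
Proof.
rewrite [x^* \oplus z]oC [(y^* \oplus z)^* \oplus _]oA (mv_luka mvA) -!oA.
by rewrite oplusCA [y \oplus _]oC oplusNx oplusx1.
Qed.

Lemma mv_le_trans y x z : mv_le x y -> mv_le y z -> mv_le x z.
Proof.
move=> /mv_leP xy /mv_leP yz; apply/mv_leP.
by have := imp_transitive x y z; rewrite xy yz compl_one !oplus0x.
Qed.

(** Residuation, from which the monotonicity of both operations is read off. *)
Lemma mv_residual x y z : mv_le (x \odot y) z <-> mv_le x (y^* \oplus z).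
Proof. by rewrite !mv_leP compl_odot -oA. Qed.

Lemma odot_monol x y z : mv_le x y -> mv_le (x \odot z) (y \odot z).
Proof.
move=> xy; apply/mv_residual/(mv_le_trans xy)/mv_residual.
exact/mv_leP/oplusNx.
Qed.

Lemma oplus_monor x y z : mv_le x y -> mv_le (z \oplus x) (z \oplus y).
Proof.
move=> xy; rewrite -[z](mv_complK mvA); apply/mv_residual.
rewrite odotC -/(meet _ _) meetC; exact: mv_le_trans (meet_lel _ _) xy.
Qed.

Lemma meet_monol x y z : mv_le x y -> mv_le (x \wedge z) (y \wedge z).
Proof.
move=> xy; rewrite !(meetC _ z) /meet ![z \odot _]odotC.
exact/odot_monol/oplus_monor.
Qed.

(** Below, [x - y] stands for [x \odot y^*]. The left side unfolds to the meet of [x] with [x - y],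
    and [x - y] lies below [x]. This trades the meets of the product axioms for plain
    differences. *)
Lemma ominus_meet x y : x \odot (x \wedge y)^* = x \odot y^*.
Proof.
rewrite compl_odot -/(meet x _) meetC compl_oplus (mv_complK mvA).
exact/mv_le_meet/odot_le.
Qed.

Lemma ominusK x y : x \odot (x \odot y^*)^* = x \wedge y.
Proof. by rewrite compl_odot (mv_complK mvA). Qed.

(** The meet is rearranged into a product with both [x] and [x^*] among its factors. *)
Lemma ominus_disjoint x y : (x \odot y^*) \wedge (y \odot x^*) = zero A.
Proof.
have meetN (u v : A) : u^* \odot (u \oplus v) = u^* \wedge v.
  by rewrite /meet (mv_complK mvA).
set w := y \odot x^*.
rewrite /meet compl_odot (mv_complK mvA) -odotA [x^* \oplus y]oC -oA meetN.
rewrite meetC /meet odotA -/(meet x w) meetC /meet.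
(* The factors of [w] are separated: [x^*] is kept, while [y] forms a meet that will release the
   factor [x]. *)
have -> : w \odot (w^* \oplus x) \odot ((x^* \oplus w)^* \oplus y^*) =
          (x^* \odot (w^* \oplus x)) \odot (y \odot ((x^* \oplus w)^* \oplus y^*)).
  rewrite /w [y \odot _]odotC -!odotA; congr odot.
  by rewrite !odotA [y \odot _]odotC.
rewrite [_ \oplus y^*]oC -/(meet y _) meetC.
rewrite compl_oplus (mv_complK mvA) /meet.
rewrite odotC -!odotA.
have -> (s t u : A) : x \odot (s \odot (t \odot (x^* \odot u))) =
                      x \odot x^* \odot (s \odot (t \odot u)).
  by rewrite -odotA; congr odot; rewrite !odotA [_ \odot x^*]odotC !odotA.
by rewrite odotxN odot0x.
Qed.

(** Disjointness gives [x - z = (x - z) - (y - z)], and the right side is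
    [x - (z \oplus (y - z)) = x - y] because [z] lies below [y]. *)
Lemma ominus_lower x y z : mv_le z y ->
  (x \odot z^*) \wedge (y \odot z^*) = zero A -> x \odot z^* = x \odot y^*.
Proof.
move=> zy d; rewrite -[LHS]odotx1 -(mv_complK mvA (one A)) compl_one -d.
rewrite ominus_meet -odotA; congr odot; rewrite -compl_oplus; congr (_^*).
move/mv_leP: zy => zy.
rewrite oC /odot (mv_complK mvA) (mv_luka mvA).
by rewrite zy compl_one oplus0x.
Qed.

End MVTheory.

(** * Soundness *)

Section Product.
Context {R : realType} {A : fmvSig R} (fA : is_fmv A).
Implicit Types x y z : A.
Local Open Scope fmv_scope.
Let mvA := fmv_mv fA.

Lemma prd_ominus_le x y z : mv_le y x ->
  z \cdot (x \odot y^*) = z \cdot x \odot (z \cdot y)^*.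
Proof.
by move=> /(mv_le_meet mvA) E; have := fmv_prdDr fA x y z; rewrite (meetC mvA) E.
Qed.

(** As [y] lies below [x], it equals [x - (x - y)]; hence [z y = z x - z (x - y)]. *)
Lemma prd_mono x y z : mv_le y x -> mv_le (z \cdot y) (z \cdot x).
Proof.
move=> yx; rewrite -[y](mv_le_meet mvA yx) (meetC mvA) -(ominusK mvA).
rewrite prd_ominus_le; last exact: odot_le.
exact: odot_le.
Qed.

Lemma prd_ominus x y z : z \cdot (x \odot y^*) = z \cdot x \odot (z \cdot y)^*.
Proof.
(* The element below [z y] in [ominus_lower] is [z (x /\ y)]. *)
rewrite -(ominus_meet mvA) (fmv_prdDr fA); apply: (ominus_lower mvA).
  by apply: prd_mono; rewrite (meetC mvA); exact: odot_le.
rewrite -(fmv_prdDr fA) [x \wedge y](meetC mvA) -(fmv_prdDr fA).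
rewrite !(ominus_meet mvA) (meetC mvA y x) (ominus_meet mvA).
(* The disjointness axiom multiplies one side of a meet only, so it is applied to each side in
   turn. *)
have [_] := fmv_prd_disj fA z (ominus_disjoint mvA x y).
rewrite (meetC mvA) => /(fmv_prd_disj fA z)[_].
by rewrite (meetC mvA).
Qed.

Hypothesis comA : commutative_fmv A.

(* The identity [u] is the top: [1 = u 1 <= 1 1] gives [1 1 = 1 = u 1], so
   [1 - u = (1 - u) u <= (1 - u) 1 = 0]. *)
Lemma prdx1 : unital A -> right_id (one A) (@prd R A).
Proof.
case=> u [ul ur]; suff -> : one A = u by [].
have e11 : one A \cdot one A = one A.
  apply: (mv_le_anti mvA (mv_le1 mvA _)).
  by rewrite -{1}[one A]ur; apply/prd_mono/(mv_le1 mvA).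
apply: (mv_le_anti mvA _ (mv_le1 mvA _)); rewrite /mv_le.
apply: (mv_lex0 mvA); rewrite -[X in mv_le X]ur.
have := prd_mono (one A \odot u^*) (mv_le1 mvA u).
rewrite [_ \cdot one A]comA prd_ominus e11 [one A \cdot u]ur.
by rewrite (odotxN mvA).
Qed.

Lemma prd_lel x y : unital A -> mv_le (x \cdot y) x.
Proof.
by move=> uA; rewrite -[X in mv_le _ X](prdx1 uA); apply/prd_mono/(mv_le1 mvA).
Qed.

End Product.

Section Soundness.
Context {R : realType} {A : fmvSig R} (fA : is_fmv A).
Context (e : formula R -> A) (ev : evaluation e).
Implicit Types p q : formula R.
Local Open Scope fmv_scope.
Let mvA := fmv_mv fA.

Let evE := (ev_imp ev, ev_neg ev, ev_nabla ev, ev_prd ev).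

Lemma ev_fiff p q : e p = e q -> e (p <~> q)%fml = one A.
Proof.
move=> E; rewrite /fiff /fodot /foplus !evE E !(mv_complK mvA).
by rewrite !(oplusNx mvA) (compl_one mvA) (oplus0x mvA).
Qed.

Lemma axiom_sound (uA : unital A) (cA : commutative_fmv A) p :
  fmvl_axiom p -> e p = one A.
Proof.
have impE (x y : A) : x^* \oplus y = (x \odot y^*)^*.
  by rewrite (compl_odot mvA) (mv_complK mvA).
case=> {p}.
- by move=> p q; rewrite !evE (oplusCA mvA) (oplusNx mvA) (oplusx1 mvA).
- by move=> p q r; rewrite !evE (imp_transitive mvA).
- by move=> p q; rewrite !evE (mv_luka mvA) (oplusNx mvA).
- move=> p q; rewrite !evE (mv_complK mvA) (mv_oplusC mvA _ (e q)).
  by rewrite (oplusNx mvA).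
(* Complementation turns [Nabla] into scaling, so (R1) is [fmv_scalB] at [(e q)^*] and [(e p)^*]. *)
- move=> a p q; apply: ev_fiff; rewrite !evE !impE; congr compl.
  rewrite (mv_complK mvA (e p \odot _)) (mv_complK mvA (scal a (e q)^*)).
  by rewrite (odotC mvA (compl _)) -(fmv_scalB fA) (mv_complK mvA) (odotC mvA).
- move=> a b p; apply: ev_fiff; rewrite !evE (fmv_scalBl fA).
  by rewrite (compl_odot mvA) !(mv_complK mvA) (mv_oplusC mvA).
- by move=> a b p; apply: ev_fiff; rewrite !evE (mv_complK mvA) (fmv_scalA fA).
- by move=> p; apply: ev_fiff; rewrite !evE (fmv_scal1 fA) (mv_complK mvA).
- move=> p q r; apply: ev_fiff; rewrite /fominus !evE !impE.
  by rewrite !(mv_complK mvA) (prd_ominus fA).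
- by move=> p q r; apply: ev_fiff; rewrite !evE (fmv_prdA fA).
- by move=> p; rewrite !evE (oplusNx mvA) (prdx1 fA cA uA) (oplusNx mvA).
- by move=> p q; rewrite !evE; apply/(mv_leP mvA)/(prd_lel fA cA).
- by move=> p q; apply: ev_fiff; rewrite !evE cA.
- by move=> a p q; apply: ev_fiff; rewrite /Delta !evE !(mv_complK mvA) (fmv_scalAl fA).
- by move=> a p q; apply: ev_fiff; rewrite /Delta !evE !(mv_complK mvA) (fmv_scalAr fA).
Qed.

Lemma derivable_sound (Theta : set (formula R)) (uA : unital A)
    (cA : commutative_fmv A) p :
  (forall t, Theta t -> e t = one A) -> derivable Theta p -> e p = one A.
Proof.
move=> eT; elim=> {p} [p|p|p q _ ep _]; [exact: axiom_sound|exact: eT|].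
by rewrite evE ep (compl_one mvA) (oplus0x mvA).
Qed.

End Soundness.

(** * The Lindenbaum algebra *)

Section Lindenbaum.
Context {R : realType} {Theta : set (formula R)}.
Implicit Types p q r : formula R.
Local Notation "|- p" := (derivable Theta p) (at level 70).
Local Notation "[ p ]" := (cls Theta p : fMVL Theta) (at level 0).
Local Open Scope fmv_scope.

(** Internal form of [imp_swap]: [q] yields [(q ~> r) ~> r], which (L2) composes with
    [p ~> (q ~> r)]. *)
Lemma imp_exchange p q r : |- ((p ~> (q ~> r)) ~> (q ~> (p ~> r)))%fml.
Proof.
apply/imp_swap/(imp_trans _ (imp_swap (D_axiom _ (L2 p (q ~> r)%fml r)))).
exact/imp_swap/imp_refl.
Qed.

Lemma cls_one p : [p] = one (fMVL Theta) <-> |- p.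
Proof.
rewrite one_fMVL; split=> [/(congr1 sval)/= E|Hp].
  have : [set q | derivable Theta q]%classic p by rewrite -E; exact: lequiv_refl.
  by [].
rewrite -[RHS]lreprK; apply/clsP.
(* The representative chosen for the class of theorems is itself a theorem, so (L1) makes it
   equivalent to [p]. *)
have Hl : |- lrepr (lone Theta).
  have : sval (lone Theta) (lrepr (lone Theta)).
    by rewrite -[X in sval X]lreprK; exact: lequiv_refl.
  by [].
by split; [exact: D_MP Hl (D_axiom _ (L1 _ _))|exact: D_MP Hp (D_axiom _ (L1 _ _))].
Qed.

Lemma cls_imp p q : [p ~> q]%fml = [p]^* \oplus [q].
Proof.
rewrite cls_compl cls_oplus; apply/clsP.
by split; apply: imp_suffix; [exact: neg_negE|exact: neg_negI].
Qed.

Lemma cls_fiff p q : |- (p <~> q)%fml -> [p] = [q].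
Proof. by move=> pq; apply/clsP; split; [exact: iffLR pq|exact: iffRL pq]. Qed.

Lemma cls_ind (P : fMVL Theta -> Prop) : (forall p, P [p]) -> forall x, P x.
Proof. by move=> Pcls x; rewrite -[x]lreprK. Qed.

Lemma fMVL_is_mv : is_mv (fMVL Theta).
Proof.
have oC : commutative (@oplus R (fMVL Theta)).
  elim/cls_ind=> p; elim/cls_ind=> q; rewrite !cls_oplus; apply/clsP.
  have swap p' q' : |- ((Neg p' ~> q') ~> (Neg q' ~> p'))%fml.
    exact: imp_trans (imp_prefix _ (neg_negI _)) (D_axiom _ (L4 _ _)).
  by split; exact: swap.
have K : involutive (@compl R (fMVL Theta)).
  elim/cls_ind=> p; rewrite !cls_compl; apply/clsP.
  by split; [exact: neg_negE|exact: neg_negI].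
split=> //.
- elim/cls_ind=> p; elim/cls_ind=> q; elim/cls_ind=> r.
  (* After two commutations, associativity is the exchange of the premises [Neg p] and [Neg r]. *)
  rewrite [RHS]oC [_ \oplus [r]]oC !cls_oplus; apply/clsP.
  by split; exact: imp_exchange.
- elim/cls_ind=> p; rewrite oC.
  have one_imp : [p ~> p]%fml = one _ by apply/cls_one/imp_refl.
  (* With the top written as the class of [p ~> p], neutrality of zero says that [(p ~> p) ~> p] is
     equivalent to [p]. *)
  rewrite -[zero _]K -/(one _) -one_imp -cls_imp; apply/clsP; split.
    exact: D_MP (imp_refl p) (imp_swap (imp_refl _)).
  exact: D_axiom (L1 _ _).
- elim/cls_ind=> p; have one_imp : [p ~> p]%fml = one _ by apply/cls_one/imp_refl.
  rewrite -/(one _) -one_imp cls_oplus one_imp; apply/cls_one.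
  exact: D_MP (imp_refl p) (D_axiom _ (L1 _ _)).
- elim/cls_ind=> p; elim/cls_ind=> q; rewrite -!cls_imp; apply/clsP.
  by split; exact: D_axiom (L3 _ _).
Qed.

Let mvL := fMVL_is_mv.

Lemma cls_ominus p q : [p \ominus q]%fml = [p] \odot [q]^*.
Proof. by rewrite /fominus -cls_compl cls_imp (compl_oplus mvL) (mv_complK mvL). Qed.

Lemma cls_le p q : mv_le [p] [q] <-> |- (p ~> q)%fml.
Proof. by rewrite -cls_one cls_imp; exact: mv_leP. Qed.

Lemma cls_nabla a p : [Nabla a p] = (scal a [p]^*)^*.
Proof.
rewrite cls_compl cls_scal cls_compl; apply/clsP; split.
  exact: imp_trans (nabla_mono a (neg_negI p)) (neg_negI _).
exact: imp_trans (neg_negE _) (nabla_mono a (neg_negE p)).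
Qed.

Lemma cls_evaluation : evaluation (cls Theta : _ -> fMVL Theta).
Proof.
split=> *; [exact: cls_imp|exact/esym/cls_compl|exact: cls_nabla|].
exact/esym/cls_prd.
Qed.

Lemma scal_compl_nabla a p : scal a [p]^* = [Nabla a p]^*.
Proof. by rewrite cls_nabla (mv_complK mvL). Qed.

(** Scaling a complement gives the complement of a [Nabla], so on complements the scalar laws become
    (R1)-(R4). *)
Lemma cls_compl_ind (P : fMVL Theta -> Prop) :
  (forall p, P [p]^*) -> forall x, P x.
Proof.
move=> Pcls; elim/cls_ind=> p; rewrite -[[p]](mv_complK mvL) cls_compl.
exact: Pcls.
Qed.

Lemma fMVL_prdC : commutative_fmv (fMVL Theta).
Proof.
elim/cls_ind=> p; elim/cls_ind=> q; rewrite !cls_prd.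
exact/cls_fiff/D_axiom/P5.
Qed.

Lemma fMVL_unital : unital (fMVL Theta).
Proof.
suff prd1 : right_id (one _) (@prd R (fMVL Theta)).
  by exists (one _); split=> // x; rewrite fMVL_prdC.
elim/cls_ind=> p.
have <- : [p ~> p]%fml = one _ by apply/cls_one/imp_refl.
by rewrite cls_prd; apply/clsP; split; apply: D_axiom; [exact: P4|exact: P3].
Qed.

Lemma fMVL_is_fmv : is_fmv (fMVL Theta).
Proof.
(* (P1) allows any subtrahend, so the distributivity axioms, whose subtrahend is a meet, are
   instances of it up to commutativity. *)
have prdB (x y z : fMVL Theta) : z \cdot (x \odot y^*) = z \cdot x \odot (z \cdot y)^*.
  elim/cls_ind: x => p; elim/cls_ind: y => q; elim/cls_ind: z => r.
  by rewrite -cls_ominus !cls_prd -cls_ominus; exact/cls_fiff/D_axiom/P1.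
have prd_le (x y : fMVL Theta) : mv_le (x \cdot y) x.
  elim/cls_ind: x => p; elim/cls_ind: y => q; rewrite cls_prd cls_le.
  exact/D_axiom/P4.
(* By (P4), [x z] lies below [x], so its meet with [y] lies below zero. *)
have prd_disj (x y z : fMVL Theta) : x \wedge y = zero _ -> (x \cdot z) \wedge y = zero _.
  by move=> xy; apply: (mv_lex0 mvL); rewrite -xy; exact: (meet_monol mvL).
split=> //.
- elim/cls_ind=> p; elim/cls_ind=> q; elim/cls_ind=> r; rewrite !cls_prd.
  exact/cls_fiff/D_axiom/P2.
- by move=> x y z; rewrite ![_ \cdot z]fMVL_prdC.
- by move=> x y z xy; rewrite (fMVL_prdC z); split; exact: prd_disj.
- move=> a; elim/cls_compl_ind=> p; elim/cls_compl_ind=> q.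
  rewrite (odotC mvL) -(compl_oplus mvL) -cls_imp !scal_compl_nabla.
  rewrite (cls_fiff (D_axiom _ (R1 _ _ _))) cls_imp (compl_oplus mvL).
  exact: odotC.
- move=> a b; elim/cls_compl_ind=> p; rewrite !scal_compl_nabla.
  rewrite (cls_fiff (D_axiom _ (R2 _ _ _))) cls_imp (compl_oplus mvL).
  exact: odotC.
- move=> a b; elim/cls_compl_ind=> p; rewrite !scal_compl_nabla.
  by rewrite (cls_fiff (D_axiom _ (R3 _ _ _))).
- elim/cls_compl_ind=> p; rewrite scal_compl_nabla.
  by rewrite (cls_fiff (D_axiom _ (R4 _))).
- move=> a; elim/cls_ind=> p; elim/cls_ind=> q.
  by rewrite !(cls_scal,cls_prd); exact/cls_fiff/D_axiom/A1.
- move=> a; elim/cls_ind=> p; elim/cls_ind=> q.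
  by rewrite !(cls_scal,cls_prd); exact/cls_fiff/D_axiom/A2.
Qed.

End Lindenbaum.

(** * Completeness *)

Section Completeness.
Context {R : realType}.
Implicit Types (p q r a b c : formula R) (Theta X Y : set (formula R)).
Local Open Scope classical_set_scope.
Local Notation "T |- p" := (derivable T p) (at level 70).

Lemma derivable_mono X Y p : X `<=` Y -> X |- p -> Y |- p.
Proof.
move=> XY; elim=> {p} [p|p /XY|p q _ Yp _ Ypq].
- exact: D_axiom.
- exact: D_hyp.
- exact: D_MP Yp Ypq.
Qed.

Lemma iter_imp_mono Theta n a p q :
  Theta |- (p ~> q)%fml -> Theta |- (iter n (Imp a) p ~> iter n (Imp a) q)%fml.
Proof. by move=> pq; elim: n => //= n; exact: imp_prefix. Qed.

Lemma iter_imp_swap Theta n a p q :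
  Theta |- (iter n (Imp a) (p ~> q)%fml ~> (p ~> iter n (Imp a) q))%fml.
Proof.
elim: n => [|n IH] /=; first exact: imp_refl.
exact: imp_trans (imp_prefix _ IH) (imp_exchange _ _ _).
Qed.

(** The logic has no contraction, so the number [n] of uses of [a] has to be recorded. *)
Lemma deduction Theta a p :
  (Theta `|` [set a]) |- p -> exists n, Theta |- iter n (Imp a) p.
Proof.
elim=> {p} [p ax|p [Tp| ->]|p q _ [n IHp] _ [m IHpq]].
- by exists 0; exact: D_axiom.
- by exists 0; exact: D_hyp.
- by exists 1; exact: imp_refl.
(* Modus Ponens adds the uses of [a] made by its two premises. *)
- exists (n + m); rewrite iterD; apply: (D_MP IHp); apply: iter_imp_mono.
  exact: D_MP IHpq (iter_imp_swap _ _ _ _ _).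
Qed.

(** From [a ~> c] the disjunction becomes [c \vee b], which (L3) flips to [(b ~> c) ~> c]. *)
Lemma vee_elim Theta a b c : Theta |- (a \vee b)%fml ->
  Theta |- (a ~> c)%fml -> Theta |- (b ~> c)%fml -> Theta |- c.
Proof.
move=> ab ac bc; apply: (D_MP bc); apply: D_MP (D_axiom _ (L3 c b)).
exact: imp_trans (imp_suffix _ ac) ab.
Qed.

(** Premises are discharged one at a time: first all copies of [a] against a single [b], then the
    copies of [b]. The conclusion is generalised to absorb the innermost premise, and (L1) weakens
    the other hypothesis to match. *)
Lemma vee_elim_iter Theta n m a b c : Theta |- (a \vee b)%fml ->
  Theta |- iter n (Imp a) c -> Theta |- iter m (Imp b) c -> Theta |- c.
Proof.
move=> ab; have elimL k d : Theta |- iter k (Imp a) d ->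
    Theta |- (b ~> d)%fml -> Theta |- d.
  elim: k d => // k IH d; rewrite iterSr => akd bd; apply: (vee_elim ab _ bd).
  exact: IH akd (imp_trans bd (D_axiom _ (L1 _ _))).
elim: m c => // m IH c anc; rewrite iterSr => bmc; apply: (elimL n) => //.
apply: IH bmc; apply: (D_MP anc); apply: iter_imp_mono.
exact: D_axiom (L1 _ _).
Qed.

(** The complement of [ominus_disjoint] in the Lindenbaum algebra. *)
Lemma prelinearity Theta p q : Theta |- ((p ~> q) \vee (q ~> p))%fml.
Proof.
have mvL := @fMVL_is_mv R Theta.
rewrite -cls_one 2!cls_imp (mv_luka mvL) -[RHS](mv_complK mvL) (compl_one mvL).
rewrite -(ominus_disjoint mvL (cls Theta p : fMVL Theta) (cls Theta q)).
rewrite -!cls_ominus -!cls_compl /meet (compl_odot mvL) (mv_complK mvL).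
by rewrite (mv_oplusC mvL) [X in compl X](mv_oplusC mvL).
Qed.

(** Compactness along a chain: the members used by the two premises of Modus Ponens are comparable,
    and the larger serves both. The first alternative covers the empty chain. *)
Lemma derivable_chain Theta (F : set (set (formula R))) p :
  total_on F (fun X Y => X `<=` Y) -> (Theta `|` \bigcup_(X in F) X) |- p ->
  Theta |- p \/ exists2 X, F X & (Theta `|` X) |- p.
Proof.
move=> tF; elim=> {p} [p ax|p [Tp|[X FX Xp]]|p q _ IHp _ IHpq].
- by left; exact: D_axiom.
- by left; exact: D_hyp.
- by right; exists X => //; apply: D_hyp; right.
- have up X r : Theta |- r -> (Theta `|` X) |- r.
    exact/derivable_mono/subsetUl.
  have upU X Y r (XY : X `<=` Y) : (Theta `|` X) |- r -> (Theta `|` Y) |- r.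
    exact/derivable_mono/setUS.
  case: IHp IHpq => [Tp|[X FX Xp]] [Tpq|[Y FY Ypq]].
  + by left; exact: D_MP Tp Tpq.
  + by right; exists Y => //; exact: D_MP (up _ _ Tp) Ypq.
  + by right; exists X => //; exact: D_MP Xp (up _ _ Tpq).
  + have [XY|YX] := tF X Y FX FY; right.
      by exists Y => //; exact: D_MP (upU _ _ _ XY Xp) Ypq.
    by exists X => //; exact: D_MP Xp (upU _ _ _ YX Ypq).
Qed.

Lemma maximal_nonderivable Theta phi : ~ Theta |- phi ->
  exists T : set (formula R), [/\ Theta `<=` T, ~ T |- phi &
    forall p, ~ T |- p -> (T `|` [set p]) |- phi].
Proof.
move=> Tphi.
(* Zorn is applied to the sets added to [Theta] rather than to supersets of [Theta], so that the
   empty union stays admissible. *)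
have [|X [XP Xmax]] := @Zorn_bigcup _ [set X | ~ (Theta `|` X) |- phi].
  by move=> F FP tF /(derivable_chain tF)[//|[X /FP]].
exists (Theta `|` X); split=> // p Xp; apply: contrapT; rewrite -setUA.
(* Adding [p] enlarges [X] strictly, since a member of [X] would be derivable. *)
apply: Xmax; split; first exact: subsetUl.
by move=> /(_ p (or_intror erefl)) Xp'; apply/Xp/D_hyp; right.
Qed.

Lemma nonderivable_totally_ordered Theta phi : ~ Theta |- phi ->
  exists T : set (formula R),
    [/\ Theta `<=` T, ~ T |- phi & totally_ordered (fMVL T)].
Proof.
move=> /maximal_nonderivable[T [TT Tphi Tmax]]; exists T; split=> //.
elim/(@cls_ind R T)=> p; elim/(@cls_ind R T)=> q; rewrite !cls_le.
have [|pq] := pselect (T |- (p ~> q)%fml); first by left.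
have [|qp] := pselect (T |- (q ~> p)%fml); first by right.
have [n npq] := deduction (Tmax _ pq); have [m mqp] := deduction (Tmax _ qp).
by case: Tphi; exact: vee_elim_iter (prelinearity _ _ _) npq mqp.
Qed.

End Completeness.

Theorem theorem4p2 (R : realType) (Theta : set (formula R)) (phi : formula R) :
  [<-> derivable Theta phi;
       forall A : fmvAlgebra R, unital A -> commutative_fmv A ->
         models Theta A phi;
       forall A : fmvAlgebra R, totally_ordered A -> unital A ->
         commutative_fmv A -> models Theta A phi;
       cls Theta phi = lone Theta :> fMVL Theta].
Proof.
tfae.
- by move=> Tphi A uA cA e ev eT; apply: (derivable_sound (fmv_axioms A) ev uA cA eT).
- by move=> sound A _; exact: sound.
- move=> complete; rewrite -one_fMVL; apply/cls_one; apply: contrapT.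
  move=> /nonderivable_totally_ordered[T [ThetaT Tphi Ttot]]; apply: Tphi.
  apply/cls_one; apply: (complete (FmvAlgebra (@fMVL_is_fmv _ T))) => //.
  + exact: fMVL_unital.
  + exact: fMVL_prdC.
  + exact: cls_evaluation.
  + by move=> t /ThetaT Tt; exact/cls_one/D_hyp.
- by move=> E; apply/cls_one; rewrite one_fMVL.
Qed.
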